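(* Let $V$ be a $C_2$ co-finite vertex operator algebra of CFT type, with $X$ and $Q$ as fixed in the context. Let $W$ be a weak $V$-module generated by an element $w\in W$, and let $L$ be the integer attached to $(W,w)$ in the context. Then $W$ is spanned by the elements of the form $$x^{1}_{-n_1} x^{2}_{-n_2}\cdots x^{k}_{-n_k}w,$$ where $k\ge 0$, $x^i\in X$ for $1\le i\le k$, the $n_i$ are integers with $n_1\ge n_2\ge\cdots\ge n_k>-L$, and in addition: if $n_j>0$ then $n_j>n_{j'}$ for all $j'>j$; and if $n_j\le 0$ then $n_j=n_{j'}$ for at most $Q-1$ indices $j'\in\{1,\dots,k\}$.
   Context: A vertex operator algebra $V=(V,Y,\mathbf 1,\omega)$ (over $\mathbb C$, with $Y(u,z)=\sum_{n\in\mathbb Z}u_nz^{-n-1}$) is of CFT type if its weight decomposition is $V=\bigoplus_{n\ge 0}V(n)$ with $V(0)=\mathbb C\mathbf 1$; write $\mathrm{wt}(v)=n$ for $v\in V(n)$. $C_2(V)$ is the linear span of $\{u_{-2}v: u,v\in V\}$, and $V$ is $C_2$ co-finite if $V/C_2(V)$ is finite dimensional. A weak $V$-module is a vector space $M$ with a linear map $Y_M:V\to \mathrm{End}(M)[[z,z^{-1}]]$, $v\mapsto Y_M(v,z)=\sum_{n\in\mathbb Z}v_nz^{-n-1}$, such that $v_nm=0$ for $n\gg 0$ (for each $v\in V$, $m\in M$), $Y_M(\mathbf 1,z)=\mathrm{Id}_M$, and the Jacobi identity holds; no grading is assumed. $W$ is generated by $w$ if $W$ is spanned by the vectors $u^1_{m_1}\cdots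 u^s_{m_s}w$ with $s\ge 0$, $u^i\in V$, $m_i\in\mathbb Z$. Fix a finite set $\bar X\subset V$ of homogeneous elements, containing $\mathbf 1$, whose images form a basis of $V/C_2(V)$, and put $X=\bar X\setminus\{\mathbf 1\}$. Let $B=\max_{x\in X}\mathrm{wt}(x)$. Fix an integer $N>0$ with $\bigoplus_{i\ge N}V(i)\subset C_2(V)$ (such $N$ exists), and put $Q=\max\{N,2B-1\}+1$. For a weak $V$-module $W$ and $w\in W$: for $x\in X$ let $l_x\ge 0$ be the integer with $x_{l_x}w\ne 0$ and $x_{l_x+k}w=0$ for all $k>0$ (with $l_x=0$ if $x_mw=0$ for all $m\ge 0$), and put $L=\max_{x\in X}\{l_x\}+1$. A maximum over the empty set is taken to be $0$. *)

(* Defs.v *)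
From mathcomp Require Import all_boot all_order all_algebra.
From mathcomp Require Import finmap.
From mathcomp Require Import all_classical all_reals.

Set Implicit Arguments.
Unset Strict Implicit.
Unset Printing Implicit Defensive.

Import Order.TTheory GRing.Theory Num.Theory.

Local Open Scope classical_set_scope.
Local Open Scope ring_scope.

Section LinearAlgebra.
Context {F : numFieldType} {M : lmodType F}.

Definition lspan (S : set M) : set M :=
  [set v | exists2 s : seq (F * M), (forall p, p \in s -> S p.2)
                                  & v = \sum_(p <- s) p.1 *: p.2].

Definition subspace (S : set M) : Prop :=
  S 0 /\ forall (a : F) (u v : M), S u -> S v -> S (a *: u + v).

Definition direct_sum_decomposition (gr : int -> set M) : Prop :=
  [/\ forall n, subspace (gr n),
      forall v, exists (s : seq int) (c : int -> M),
        (forall n, gr n (c n)) /\ v = \sum_(n <- s) c n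
    & forall (s : seq int) (c : int -> M), uniq s -> (forall n, gr n (c n)) ->
        \sum_(n <- s) c n = 0 -> forall n, n \in s -> c n = 0].

Definition finite_dim (S : set M) : Prop :=
  exists s : seq M, S `<=` lspan [set` s].

Definition finite_codim (S : set M) : Prop :=
  exists s : seq M, forall v, exists2 t, lspan [set` s] t & S (v - t).

Definition basis_mod (S : set M) (X : {fset M}) : Prop :=
  (forall a : M -> F, S (\sum_(x <- X) a x *: x) ->
     forall x, x \in X -> a x = 0) /\
  (forall v, exists a : M -> F, S (v - \sum_(x <- X) a x *: x)).

End LinearAlgebra.

(* The generalized binomial coefficient m (m - 1) ... (m - i + 1) / i!. *)
Definition binz (F : numFieldType) (m : int) (i : nat) : F :=
  (\prod_(j < i) (m - j%:Z)%:~R) / (i`!)%:R.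

(* A linear map Y : V -> End(M)[[z, z^-1]], Y(u, z) = \sum_n u_n z^(-n-1), is
   given by its modes, [Y u n] being u_n. *)
Section Modes.
Context {F : numFieldType} {V M : lmodType F}.
Variables (YV : V -> int -> {linear V -> V}) (Y : V -> int -> {linear M -> M}).

Definition mode_linear : Prop :=
  forall (n : int) (m : M), linear (fun u : V => Y u n m).

Definition mode_truncation : Prop :=
  forall (u : V) (m : M), exists k : int, forall n, k <= n -> Y u n m = 0.

Definition vacuum_identity (one : V) : Prop :=
  forall (n : int) (m : M), Y one n m = if n == -1 then m else 0.

(* The coefficient of z0^(-l-1) z1^(-m-1) z2^(-n-1) in
     z0^-1 delta((z1 - z2)/z0) Y(u,z1) Y(v,z2) w
       - z0^-1 delta((z2 - z1)/(-z0)) Y(v,z2) Y(u,z1) w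
     = z2^-1 delta((z1 - z0)/z2) Y(Y(u,z0)v,z2) w,
   negative powers of a binomial being expanded in nonnegative powers of its
   second term.  On the right, (-1)^i binz (i - m - 1) i has been written as
   binz m i.  Under [mode_truncation] (for YV and Y) both sums over i have
   finite support. *)
Definition jacobi_identity : Prop :=
  forall (u v : V) (w : M) (l m n : int),
    \sum_(i \in [set: nat])
       ((-1) ^+ i * binz F l i) *:
         (Y u (m + l - i%:Z) (Y v (n + i%:Z) w)
          - (-1) ^ l *: Y v (n + l - i%:Z) (Y u (m + i%:Z) w))
    = \sum_(i \in [set: nat])
       binz F m i *: Y (YV u (l + i%:Z) v) (m + n - i%:Z) w.

(* [mode_word [:: (u1, m1); ...; (us, ms)] w] is u1_m1 (... (us_ms w)). *)
Definition mode_word (s : seq (V * int)) (w : M) : M :=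
  foldr (fun p acc => Y p.1 p.2 acc) w s.

End Modes.

(* Here L(n) = omega_(n+1) and c is the central charge. *)
Definition virasoro_relations (F : numFieldType) (V : lmodType F)
    (Y : V -> int -> {linear V -> V}) (omega : V) (c : F) : Prop :=
  let L (n : int) := Y omega (n + 1) in
  forall (m n : int) (v : V),
    L m (L n v) - L n (L m v)
    = (m - n)%:~R *: L (m + n) v
      + (if m + n == 0 then (m ^+ 3 - m)%:~R / 12%:R * c else 0) *: v.

Record vertexOperatorAlgebra (F : numFieldType) := VertexOperatorAlgebra {
  voa_sort :> lmodType F;
  voa_mode : voa_sort -> int -> {linear voa_sort -> voa_sort};
  vacuum : voa_sort;
  conformal : voa_sort;
  central_charge : F;
  wspace : int -> set voa_sort;
  voa_decomposition : direct_sum_decomposition wspace;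
  voa_finite_dim : forall n, finite_dim (wspace n);
  voa_bounded_below : exists n0 : int, forall n, n < n0 -> wspace n = [set 0];
  voa_vacuum_weight : wspace 0 vacuum;
  voa_conformal_weight : wspace 2 conformal;
  voa_linear : mode_linear voa_mode;
  voa_truncation : mode_truncation voa_mode;
  voa_vacuum : vacuum_identity voa_mode vacuum;
  voa_creation : forall v, voa_mode v (-1) vacuum = v /\
    forall n : int, 0 <= n -> voa_mode v n vacuum = 0;
  voa_jacobi : jacobi_identity voa_mode voa_mode;
  voa_virasoro : virasoro_relations voa_mode conformal central_charge;
  voa_L0 : forall (n : int) v, wspace n v ->
    voa_mode conformal 1 v = n%:~R *: v;
  (* Y(L(-1) v, z) = d/dz Y(v, z) *)
  voa_derivative : forall v (n : int) u,
    voa_mode (voa_mode conformal 0 v) n u = - n%:~R *: voa_mode v (n - 1) u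
}.

Arguments voa_mode {F} V u n : rename.
Arguments vacuum {F} V : rename.
Arguments conformal {F} V : rename.
Arguments wspace {F} V n : rename.

Record weakModule (F : numFieldType) (V : vertexOperatorAlgebra F) :=
  WeakModule {
  wm_sort :> lmodType F;
  wm_mode : V -> int -> {linear wm_sort -> wm_sort};
  wm_linear : mode_linear wm_mode;
  wm_truncation : mode_truncation wm_mode;
  wm_vacuum : vacuum_identity wm_mode (vacuum V);
  wm_jacobi : jacobi_identity (voa_mode V) wm_mode
}.

Arguments wm_mode {F V} W u n : rename.

Section Voa.
Context {F : numFieldType} (V : vertexOperatorAlgebra F).

Definition CFT_type : Prop :=
  (forall n : int, n < 0 -> wspace V n = [set 0]) /\
  wspace V 0 = lspan [set vacuum V].

Definition C2 : set V :=
  lspan [set y | exists u v : V, y = voa_mode V u (-2) v].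

Definition C2_cofinite : Prop := finite_codim C2.

Definition homogeneous (v : V) : Prop := exists n : int, wspace V n v.

(* For V of CFT type; the default value 0 is taken only at non-homogeneous v,
   and the weight of the zero vector is arbitrary. *)
Definition weight (v : V) : nat := xget 0%N [set n : nat | wspace V n%:Z v].

Definition max_weight (X : {fset V}) : nat := \max_(x <- X) weight x.

(* 2 * B - 1 is truncated at 0, which does not change the maximum for N > 0. *)
Definition repetition_bound (X : {fset V}) (N : nat) : nat :=
  (maxn N (2 * max_weight X - 1)).+1.

Definition generated_by (W : weakModule V) (w : W) : Prop :=
  lspan (range (fun s : seq (V * int) => mode_word (wm_mode W) s w))
  = [set: W].

Definition last_mode (W : weakModule V) (w : W) (x : V) : nat :=
  xget 0%N [set l : nat | wm_mode W x l%:Z w <> 0 /\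
              forall k : nat, (0 < k)%N -> wm_mode W x (l + k)%N%:Z w = 0].

Definition mode_bound (X : {fset V}) (W : weakModule V) (w : W) : nat :=
  (\max_(x <- X) last_mode w x).+1.

(* The pairs (x^1, n_1), ..., (x^k, n_k); the associated modes x^i_(-n_i) carry
   the opposite index. *)
Definition admissible (X : {fset V}) (L Q : nat) (s : seq (V * int)) : Prop :=
  let n := [seq p.2 | p <- s] in
  [/\ forall p, p \in s -> p.1 \in X,
      forall j j' : nat, (j < j' < size s)%N -> n`_j' <= n`_j,
      forall a, a \in n -> - L%:Z < a,
      forall j j' : nat, (j < j' < size s)%N -> 0 < n`_j -> n`_j' < n`_j
    & forall a, a \in n -> a <= 0 -> (count_mem a n <= Q - 1)%N].

Definition spanning_vector (W : weakModule V) (w : W) (s : seq (V * int)) : W :=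
  mode_word (wm_mode W) [seq (p.1, - p.2) | p <- s] w.

End Voa.

Arguments C2 {F} V.

(* Main.v *)
(* Filter W by total weight, the words u^1_{m_1} ... u^s_{m_s} w with
   sum_i wt(u^i) <= t spanning the t-th piece.  Commutators of modes and modes of
   elements of C_2(V) lower the total weight, so modulo lower pieces the letters
   commute and may be taken in X.  At fixed weight we induct on the length:
   (x_{-1} y)_{2c+1} is a single letter, and it is the sum of all normally ordered
   products x_a y_b and y_b x_a with a + b = 2c, so a repeated mode x_c y_c can be
   traded for pairs with a <> b.  Such a trade fixes the sum of the indices and
   increases the sum of their squares, while a word with an index >= L vanishes
   modulo lower weight (move that mode to the right), so the process stops.  This
   makes all the n_j distinct, of either sign, which is stronger than allowing
   Q - 1 repetitions. *)
Require Import Defs.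
From mathcomp Require Import all_boot all_order all_algebra.
From mathcomp Require Import finmap complex.
From mathcomp Require Import all_classical all_reals.
From mathcomp Require Import zify ring.

Set Implicit Arguments.
Unset Strict Implicit.
Unset Printing Implicit Defensive.

Import Order.TTheory GRing.Theory Num.Theory.

Local Open Scope classical_set_scope.
Local Open Scope ring_scope.

(** * Subspaces, linear spans and finitely supported sums *)

Section Subspace.
Context {F : numFieldType} {M : lmodType F}.
Implicit Types (S T : set M).

Lemma subspaceD S (u v : M) : subspace S -> S u -> S v -> S (u + v).
Proof. by move=> [_ h] Su Sv; rewrite -[u]scale1r; apply: h. Qed.

Lemma subspaceZ S (a : F) (u : M) : subspace S -> S u -> S (a *: u).
Proof. by move=> [S0 h] Su; rewrite -[_ *: _]addr0; apply: h. Qed.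

Lemma subspaceB S (u v : M) : subspace S -> S u -> S v -> S (u - v).
Proof.
by move=> sS Su Sv; apply: subspaceD => //; rewrite -scaleN1r; apply: subspaceZ.
Qed.

Lemma subspaceBr S (u v : M) : subspace S -> S (u - v) -> S v -> S u.
Proof. by move=> sS Suv Sv; rewrite -(subrK v u); apply: subspaceD. Qed.

Lemma subspace_sum S (I : eqType) (r : seq I) (G : I -> M) :
  subspace S -> (forall i, i \in r -> S (G i)) -> S (\sum_(i <- r) G i).
Proof.
move=> sS; elim: r => [|i r IH] h; first by rewrite big_nil; case: sS.
rewrite big_cons; apply: subspaceD => //; first by apply: h; rewrite mem_head.
by apply: IH => j jr; apply: h; rewrite inE jr orbT.
Qed.

Lemma subspace_fsum S (I : choiceType) (G : I -> M) :
  subspace S -> (forall i, S (G i)) -> S (\sum_(i \in [set: I]) G i).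
Proof. by move=> sS h; apply: subspace_sum. Qed.

(** Vanishing from [n] on turns the sum into a genuine finite one, from which the terms other than
    [G i0] can be subtracted inside [S]. *)
Lemma subspace_fsum_isolate S (G : nat -> M) (n i0 : nat) :
  subspace S -> (forall i, (n <= i)%N -> G i = 0) ->
  S (\sum_(i \in [set: nat]) G i) -> (forall i, i != i0 -> S (G i)) -> S (G i0).
Proof.
move=> sS G0; set r := iota 0 (maxn n i0.+1).
rewrite (fsbigTE [fset x | x in r]%fset); last first.
  by move=> i; rewrite !inE mem_iota => h; apply: G0; lia.
rewrite (bigD1_seq i0) /= ?fset_uniq //; last by rewrite !inE mem_iota; lia.
set R := \sum_(i <- _ | _) _ => SR Gi; rewrite -[G i0](addrK R).
apply: subspaceB => //; rewrite /R -big_filter.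
by apply: subspace_sum => // i; rewrite mem_filter => /andP[/Gi].
Qed.

Lemma lspan_subspace S : subspace (lspan S).
Proof.
split; first by exists [::] => //; rewrite big_nil.
move=> a u v [s hs ->] [s' hs' ->].
exists ([seq (a * p.1, p.2) | p <- s] ++ s').
  by move=> p; rewrite mem_cat => /orP[/mapP[q /hs ? ->]|/hs'].
rewrite big_cat big_map scaler_sumr; congr (_ + _).
by apply: eq_bigr => p _; rewrite scalerA.
Qed.

Lemma sub_lspan S : S `<=` lspan S.
Proof.
move=> v Sv; exists [:: (1, v)]; last by rewrite big_seq1 scale1r.
by move=> p; rewrite inE => /eqP->.
Qed.

Lemma lspan_min S T : subspace T -> S `<=` T -> lspan S `<=` T.
Proof.
move=> sT ST v [s hs ->]; apply: subspace_sum => // p ps.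
by apply: subspaceZ => //; apply/ST/hs.
Qed.

End Subspace.

Lemma subspace_preimage (F : numFieldType) (M M' : lmodType F) (S : set M')
  (f : M -> M') : subspace S -> linear f -> subspace [set v | S (f v)].
Proof.
move=> [S0 h] lf; split => /=; last by move=> a u v Su Sv; rewrite lf; apply: h.
by have := lf (-1) 0 0; rewrite scaler0 addr0 scaleN1r addNr => ->.
Qed.

(** * Homogeneous components and eigenvectors in a graded space *)

Section Grading.
Context {F : numFieldType} {M : lmodType F} (gr : int -> set M).
Hypothesis hgr : direct_sum_decomposition gr.

Lemma graded_span (v : M) : lspan (fun u => exists n, gr n u) v.
Proof.
have [_ /(_ v)[s [c [hc ->]]] _] := hgr.
apply: subspace_sum => [|n _]; first exact: lspan_subspace.
by apply: sub_lspan; exists n.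
Qed.

(** Group the terms of the combination by degree. By uniqueness of homogeneous components, the group
    of degree [h] is [u] itself. *)
Lemma graded_component (A : int -> set M) (h : int) (u : M) :
  (forall n, subspace (A n)) -> (forall n, A n `<=` gr n) -> gr h u ->
  lspan (fun u => exists n, A n u) u -> A h u.
Proof.
move=> sA Agr uh [s hs us].
have [sgr _ dgr] := hgr.
have [d hd] : exists d : F * M -> int, forall p, p \in s -> A (d p) p.2.
  have [|d hd] := @boolp.choice _ _ (fun p n => p \in s -> A n p.2); last by exists d.
  move=> p.
  case: (boolP (p \in s)) => [/hs[n An]|_]; first by exists n.
  by exists 0.
pose c n := \sum_(p <- s | d p == n) p.1 *: p.2.
have Ac n : A n (c n).
  rewrite /c -big_filter; apply: subspace_sum => // p.
  by rewrite mem_filter => /andP[/eqP<- /hd ?]; apply: subspaceZ.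
(* Including [h] guarantees that degree [h] is among those compared, even if no term has that
   degree. *)
pose r := undup (h :: map d s).
have cu : \sum_(n <- r) c n = u.
  rewrite us /c (exchange_big_dep predT) //= [RHS]big_seq [LHS]big_seq.
  apply: eq_bigr => p ps; rewrite big_mkcond (bigD1_seq (d p)) ?undup_uniq //= ?eqxx.
    by rewrite big1 ?addr0 // => i; rewrite eq_sym => /negPf->.
  by rewrite mem_undup inE map_f ?orbT.
have := dgr r (fun n => c n - (if n == h then u else 0)) (undup_uniq _).
have hr : h \in r by rewrite mem_undup mem_head.
rewrite sumrB cu (bigD1_seq h) ?undup_uniq //= eqxx.
rewrite [X in u - (u + X)]big1 => [|i /negPf-> //]; rewrite addr0 subrr.
move=> H; have {H} /(_ _ erefl h hr) := H; rewrite eqxx => H.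
rewrite (_ : u = c h) //; apply/esym/eqP; rewrite -subr_eq0; apply/eqP/H.
move=> n; apply: subspaceB => //; first exact: Agr.
by case: eqP => [->//|_]; case: (sgr n).
Qed.

(** Applying [f - h] multiplies the component of degree [n] by [n - h], which is nonzero in
    characteristic 0 unless [n = h]; so only degree [h] survives. *)
Lemma eigenvector_graded (f : {linear M -> M}) (h : int) (v : M) :
  (forall n u, gr n u -> f u = n%:~R *: u) -> f v = h%:~R *: v -> gr h v.
Proof.
move=> hf fv; have [sgr /(_ v)[s [c [hc vs]]] dgr] := hgr.
(* The list [s] may repeat a degree, so multiplicities are absorbed into the components. *)
pose c' (n : int) : M := (count_mem n s)%:R *: c n.
have hc' n : gr n (c' n) by apply: subspaceZ.
have vc' : v = \sum_(n <- undup s) c' n.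
  rewrite vs; transitivity (\sum_(n <- undup s) c n *+ count_mem n s).
    exact/esym/big_undup_iterop_count.
  by apply: eq_bigr => n _; rewrite /c' scaler_nat.
have := dgr (undup s) (fun n => (n - h)%:~R *: c' n) (undup_uniq _).
move=> H; have {H} H : forall n, n \in undup s -> (n - h)%:~R *: c' n = 0.
  apply: H => [n|]; first by apply: subspaceZ.
  transitivity (f v - h%:~R *: v); last by rewrite fv subrr.
  rewrite vc' raddf_sum scaler_sumr -sumrB.
  by apply: eq_bigr => n _; rewrite rmorphB scalerBl; congr (_ - _); apply/esym/hf.
rewrite vc'; apply: subspace_sum => // n /H /eqP.
rewrite scaler_eq0 intr_eq0 subr_eq0 => /orP[/eqP<-//|/eqP->].
by case: (sgr h).
Qed.

End Grading.

(** * Special cases of the Jacobi identity *)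

Section Modes.
Context {F : numFieldType} {V M : lmodType F}.
Variables (YV : V -> int -> {linear V -> V}) (Y : V -> int -> {linear M -> M}).

Lemma binz0 (m : int) : binz F m 0 = 1.
Proof. by rewrite /binz big_ord0 fact0 divr1. Qed.

Lemma binz_eq0 (m i : nat) : (m < i)%N -> binz F m%:Z i = 0.
Proof.
by move=> h; rewrite /binz (bigD1 (Ordinal h)) //= subrr mul0r mul0r.
Qed.

Lemma binzn1 (m : int) : binz F m 1 = m%:~R.
Proof. by rewrite /binz big_ord1 subr0 divr1. Qed.

(** These are the coefficients of the geometric series; they make every term of the expansion of
    [u_{-1} v] occur with coefficient 1. *)
Lemma sign_binzN1 (i : nat) : (-1) ^+ i * binz F (-1) i = 1.
Proof.
have -> : binz F (-1) i = (-1) ^+ i.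
  rewrite /binz; apply/(canLR (mulfK _)); first by rewrite pnatr_eq0 -lt0n fact_gt0.
  elim: i => [|i IH]; first by rewrite big_ord0 expr0 mul1r.
  rewrite big_ord_recr /= IH factS natrM exprS rmorphB /= -pmulrn -natr1.
  by ring.
by rewrite -exprMn mulrNN mulr1 expr1n.
Qed.

Hypothesis jacobi : jacobi_identity YV Y.

(** The case [l = 0] of Jacobi: [binz F 0 i] vanishes for [i > 0], so the left side reduces to the
    commutator. *)
Lemma commutator_formula (u v : V) (m n : int) (z : M) :
  Y u m (Y v n z) - Y v n (Y u m z)
  = \sum_(i \in [set: nat]) binz F m i *: Y (YV u i%:Z v) (m + n - i%:Z) z.
Proof.
have := jacobi u v z 0 m n.
rewrite (fsbigTE [fset 0%N]%fset) => [|i]; last first.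
  by rewrite inE => i0; rewrite (@binz_eq0 0) ?lt0n // mulr0 scale0r.
rewrite big_seq_fset1 binz0 expr0 mulr1 expr0z !scale1r subr0 !addr0 => ->.
by apply: eq_fsbigr => i _; rewrite add0r.
Qed.

(** The case [m = 0] of Jacobi, where the right side reduces to its term [i = 0]. *)
Lemma iterate_formula (u v : V) (l n : int) (z : M) :
  Y (YV u l v) n z = \sum_(i \in [set: nat]) ((-1) ^+ i * binz F l i) *:
     (Y u (l - i%:Z) (Y v (n + i%:Z) z)
      - (-1) ^ l *: Y v (n + l - i%:Z) (Y u i%:Z z)).
Proof.
have := jacobi u v z l 0 n.
rewrite [RHS](fsbigTE [fset 0%N]%fset) => [|i]; last first.
  by rewrite inE => i0; rewrite (@binz_eq0 0) ?lt0n // scale0r.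
rewrite big_seq_fset1 binz0 scale1r subr0 addr0 !add0r => <-.
by apply: eq_fsbigr => i _; rewrite add0r.
Qed.

(** The modes of the normally ordered product of [u] and [v]; all index pairs in it have sum
    [n - 1]. *)
Lemma iterate_formulaN1 (u v : V) (n : int) (z : M) :
  Y (YV u (-1) v) n z = \sum_(i \in [set: nat])
     (Y u (- 1 - i%:Z) (Y v (n + i%:Z) z) + Y v (n - 1 - i%:Z) (Y u i%:Z z)).
Proof.
rewrite iterate_formula; apply: eq_fsbigr => i _.
by rewrite sign_binzN1 scale1r exprN1 invrN1 scaleN1r opprK.
Qed.

End Modes.

(** * Weights of modes *)

Section Weights.
Context {F : numFieldType} (V : vertexOperatorAlgebra F).

(** The commutator of [L(0)], the mode of index 1 of the conformal vector, with [u_n] has only the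
    terms from [L(-1) u] and [L(0) u]. They contribute [-(n + 1)] and [h1], so [u_n v] is an
    [L(0)]-eigenvector of the expected weight. *)
Lemma mode_wspace (h1 h2 n : int) (u v : V) :
  wspace V h1 u -> wspace V h2 v -> wspace V (h1 + h2 - n - 1) (voa_mode V u n v).
Proof.
move=> hu hv; apply: (@eigenvector_graded _ _ _ (voa_decomposition V) (voa_mode V (conformal V) 1)).
  by move=> k x; apply: voa_L0.
have := @commutator_formula _ _ _ _ _ (@voa_jacobi _ V) (conformal V) u 1 n v.
rewrite (fsbigTE [fset 0%N; 1%N]%fset) => [|i]; last first.
  rewrite !inE => i0; rewrite (@binz_eq0 _ 1) ?scale0r //.
  by case: i i0 => [|[]].
rewrite big_fsetU1 ?inE //= big_seq_fset1 binz0 binzn1 !scale1r.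
rewrite voa_derivative (voa_L0 hu) (voa_L0 hv).
have -> : 1 + n - 0%:Z - 1 = n by lia.
have -> : 1 + n - 1%:Z = n by lia.
rewrite linearZ /=.
have -> : voa_mode V (h1%:~R *: u) n v = h1%:~R *: voa_mode V u n v.
  have lin := @voa_linear _ V n v.
  have e0 : voa_mode V 0 n v = 0.
    by have := lin (-1) 0 0; rewrite scaler0 addr0 scaleN1r addNr.
  by have := lin h1%:~R u 0; rewrite !addr0 e0 addr0.
move=> /eqP; rewrite subr_eq => /eqP ->.
rewrite -!scalerDl; congr (_ *: _).
by rewrite !(rmorphD, rmorphB, rmorphN) /=; ring.
Qed.

(** Without negative weights, a mode applied to a homogeneous vector can again serve as a letter
    with a natural weight, unless it is zero. *)
Lemma mode_wspace_nat (hCFT : CFT_type V) (h1 h2 : nat) (n : int) (u v : V) :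
  wspace V h1 u -> wspace V h2 v ->
  (exists2 h : nat, h%:Z = h1%:Z + h2%:Z - n - 1 & wspace V h (voa_mode V u n v))
  \/ voa_mode V u n v = 0.
Proof.
move=> hu hv; have := mode_wspace n hu hv.
case: (h1%:Z + h2%:Z - n - 1) => [h|h] H; first by left; exists h.
by right; case: hCFT => /(_ (Negz h) isT) E _; rewrite E in H.
Qed.

Lemma homogeneous_span (hCFT : CFT_type V) (v : V) :
  lspan (fun u => exists h : nat, wspace V h u) v.
Proof.
move: v (graded_span (voa_decomposition V) v); apply: lspan_min.
  exact: lspan_subspace.
move=> u [n]; have [n0|n0] := leP 0 n.
  by rewrite -(gez0_abs n0) => ?; apply: sub_lspan; eexists; eassumption.
by case: hCFT => [/(_ _ n0)-> _] /= ->; case: (lspan_subspace (fun u => exists h : nat, wspace V h u)).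
Qed.

End Weights.

(** * Homogeneous representatives modulo [C2 V] *)

Section C2Homogeneous.
Context {F : numFieldType} (V : vertexOperatorAlgebra F) (Xbar : {fset V}).

(** In the second case the weights of [u] and [v] add up to [n - 1] only; this drop by one drives
    the induction on weight. *)
Definition mod_C2_generator (n : int) (y : V) : Prop :=
  (y \in Xbar /\ wspace V n y) \/
  exists (h1 h2 : nat) (u v : V),
    [/\ wspace V h1 u, wspace V h2 v, n = (h1 + h2).+1 & y = voa_mode V u (-2) v].

(** The basis property expresses [u] through such generators of all weights, after splitting both
    arguments of [u_{-2} v] into homogeneous parts; projecting to weight [h] keeps those of weight
    [h]. *)
Lemma homogeneous_mod_C2 (hCFT : CFT_type V)
  (hhom : forall x : V, x \in Xbar -> homogeneous x)
  (hbasis : basis_mod (C2 V) Xbar) (h : int) (u : V) :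
  wspace V h u -> lspan (mod_C2_generator h) u.
Proof.
move=> uh; have [sgr _ _] := voa_decomposition V.
apply: (@graded_component _ _ _ (voa_decomposition V) (fun n => lspan (mod_C2_generator n))) => //.
- by move=> n; apply: lspan_subspace.
- move=> n; apply: lspan_min => // y [[]//|[h1 [h2 [a [b [ha hb -> ->]]]]]].
  by have := mode_wspace (-2) ha hb; congr (wspace V _ _); lia.
set T := lspan _; have sT : subspace T by apply: lspan_subspace.
have [_ /(_ u)[a]] := hbasis => uC2.
apply: (@subspaceBr _ _ _ _ (\sum_(x <- Xbar) a x *: x)) => //; last first.
  apply: subspace_sum => // x xX; apply: subspaceZ => //; apply: sub_lspan.
  by have [n xn] := hhom _ xX; exists n; apply: sub_lspan; left.
move: uC2; apply: lspan_min => // _ [x [y ->]].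
have := homogeneous_span hCFT x; move: x.
have sTl v : subspace [set x | T (voa_mode V x (-2) v)].
  by apply: subspace_preimage => // c p q; apply: voa_linear.
apply: (lspan_min (sTl y)) => /= x [h1 xh].
have := homogeneous_span hCFT y; move: y.
have sTr : subspace [set y | T (voa_mode V x (-2) y)].
  by apply: subspace_preimage => // c p q; apply: linearP.
apply: (lspan_min sTr) => /= y [h2 yh].
apply: sub_lspan; exists (h1 + h2).+1%N; apply: sub_lspan; right.
by exists h1, h2, x, y.
Qed.

End C2Homogeneous.

(** * Bringing two entries with equal image to the front *)

Lemma repeated_image (I J : eqType) (f : I -> J) (s : seq I) :
  ~~ uniq (map f s) -> exists p q r, perm_eq s [:: p, q & r] /\ f p = f q.
Proof.
elim: s => [//|p s IH] /=; rewrite negb_and negbK => /orP[/mapP[q qs pq]|].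
  by exists p, q, (rem q s); rewrite perm_cons perm_to_rem.
move=> /IH[a [b [r [sabr ab]]]]; exists a, b, (p :: r); split => //.
apply: (@perm_trans _ (p :: [:: a, b & r])); first by rewrite perm_cons.
by rewrite -[p :: _](cat1s p) -[[:: a, b & r]]/([:: a; b] ++ r) perm_catCA.
Qed.

(** * Words of homogeneous modes acting on [w] *)

Section Words.
Context {F : numFieldType} {V : vertexOperatorAlgebra F} (W : weakModule V) (w : W).

(* A letter (h, u, m) stands for the mode u_m, h being a weight of u. *)
Definition letter : Type := (nat * V * int)%type.

Implicit Types (p q : letter) (s r : seq letter).

Definition act s (z : W) : W := foldr (fun p z => wm_mode W p.1.2 p.2 z) z s.

Definition hom_word s : Prop := forall p, p \in s -> wspace V p.1.1%:Z p.1.2.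

Definition word_weight s : nat := \sum_(p <- s) p.1.1.

Lemma act_cat s r z : act (s ++ r) z = act s (act r z).
Proof. exact: foldr_cat. Qed.

Lemma act_linear s : linear (act s).
Proof. by elim: s => [|p s IH] a u v //=; rewrite IH linearP. Qed.

Lemma word_weight_cons p s : word_weight (p :: s) = (p.1.1 + word_weight s)%N.
Proof. exact: big_cons. Qed.

Lemma word_weight_cat s r : word_weight (s ++ r) = (word_weight s + word_weight r)%N.
Proof. exact: big_cat. Qed.

Lemma hom_word_cons p s :
  hom_word (p :: s) <-> wspace V p.1.1%:Z p.1.2 /\ hom_word s.
Proof.
split=> [h|[hp hs] q]; last by rewrite inE => /orP[/eqP->|/hs].
by split=> [|q qs]; apply: h; rewrite ?mem_head // inE qs orbT.
Qed.

Lemma hom_word_cat s r : hom_word (s ++ r) <-> hom_word s /\ hom_word r.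
Proof.
split=> [h|[hs hr] q]; last by rewrite mem_cat => /orP[/hs|/hr].
by split=> q qs; apply: h; rewrite mem_cat qs ?orbT.
Qed.

(** * Rearranging words modulo smaller total weight *)

Section Span.
Variables (S : set W) (t : nat).
Hypothesis sS : subspace S.
Hypothesis low : forall s, hom_word s -> (word_weight s < t)%N -> S (act s w).
Hypothesis hCFT : CFT_type V.

Lemma act_preimage s : subspace [set z | S (act s z)].
Proof. exact/subspace_preimage/act_linear. Qed.

Lemma mode_preimage s n z : subspace [set u | S (act s (wm_mode W u n z))].
Proof.
apply: (@subspace_preimage _ _ _ [set z | S (act s z)] (fun u => wm_mode W u n z)).
  exact: act_preimage.
by move=> a u v; apply: wm_linear.
Qed.

Lemma mode0 n z : wm_mode W 0 n z = 0.
Proof.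
by have := @wm_linear _ _ W n z (-1) 0 0; rewrite scaler0 addr0 scaleN1r addNr.
Qed.

(** Each commutator term replaces the two letters by one mode of [u_i v] with [i >= 0], of weight
    [h1 + h2 - i - 1]. So the total weight falls below [t], and the induction hypothesis [low]
    applies. *)
Lemma act_commutator s r (h1 h2 : nat) (u v : V) (m n : int) :
  hom_word s -> hom_word r -> wspace V h1 u -> wspace V h2 v ->
  (word_weight s + h1 + h2 + word_weight r <= t)%N ->
  S (act (s ++ (h1, u, m) :: (h2, v, n) :: r) w
     - act (s ++ (h2, v, n) :: (h1, u, m) :: r) w).
Proof.
move=> hs hr hu hv ht; rewrite !act_cat /=.
have -> : act s (wm_mode W u m (wm_mode W v n (act r w)))
          - act s (wm_mode W v n (wm_mode W u m (act r w)))
  = act s (wm_mode W u m (wm_mode W v n (act r w))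
           - wm_mode W v n (wm_mode W u m (act r w))).
  by rewrite -scaleN1r addrC -act_linear addrC scaleN1r.
rewrite (commutator_formula (@wm_jacobi _ _ W)).
apply: (subspace_fsum (act_preimage s)) => i.
apply: (subspaceZ _ (act_preimage s)) => /=.
have [[h hE hi]|->] := mode_wspace_nat hCFT i%:Z hu hv; last first.
  by rewrite mode0; case: (act_preimage s).
have := @low (s ++ (h, voa_mode V u i%:Z v, m + n - i%:Z) :: r).
rewrite act_cat !(word_weight_cat, word_weight_cons) /=; apply; last by lia.
by apply/hom_word_cat; split=> //; apply/hom_word_cons.
Qed.

(** The iterate formula yields words in [u] and [v], whose weight is one less than that of
    [u_{-2} v]. The strict bound on [t] is thus what remains of a word of weight at most [t]. *)
Lemma act_C2_letter s r (h1 h2 : nat) (u v : V) (n : int) :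
  hom_word s -> hom_word r -> wspace V h1 u -> wspace V h2 v ->
  (word_weight s + h1 + h2 + word_weight r < t)%N ->
  S (act s (wm_mode W (voa_mode V u (-2) v) n (act r w))).
Proof.
move=> hs hr hu hv ht; rewrite (iterate_formula (@wm_jacobi _ _ W)).
have sP := act_preimage s.
apply: (subspace_fsum sP) => i; apply: (subspaceZ _ sP).
apply: (subspaceB sP); last apply: (subspaceZ _ sP) => /=.
  have := @low (s ++ (h1, u, -2 - i%:Z) :: (h2, v, n + i%:Z) :: r).
  rewrite act_cat !(word_weight_cat, word_weight_cons) /=; apply; last by lia.
  by apply/hom_word_cat; split=> //; apply/hom_word_cons; split=> //; apply/hom_word_cons.
have := @low (s ++ (h2, v, n + -2 - i%:Z) :: (h1, u, i%:Z) :: r).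
rewrite act_cat !(word_weight_cat, word_weight_cons) /=; apply; last by lia.
by apply/hom_word_cat; split=> //; apply/hom_word_cons; split=> //; apply/hom_word_cons.
Qed.

Lemma act_move s p r1 r2 : hom_word (s ++ p :: r1 ++ r2) ->
  (word_weight (s ++ p :: r1 ++ r2) <= t)%N ->
  S (act (s ++ p :: r1 ++ r2) w - act (s ++ r1 ++ p :: r2) w).
Proof.
elim: r1 s => [|[[h2 v] n] r1 IH] s; first by rewrite !cat0s subrr; case: sS.
case: p IH => [[h1 u] m] IH hom wt.
apply: (@subspaceBr _ _ _ _ (act (s ++ (h2, v, n) :: (h1, u, m) :: r1 ++ r2) w
   - act (s ++ ((h2, v, n) :: r1) ++ (h1, u, m) :: r2) w)) => //; last first.
  have := IH (rcons s (h2, v, n)); rewrite !cat_rcons; apply.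
    by move: hom => /hom_word_cat[hs /hom_word_cons[? /hom_word_cons[? ?]]];
      apply/hom_word_cat; split=> //; apply/hom_word_cons; split=> //; apply/hom_word_cons.
  by move: wt; rewrite !(word_weight_cat, word_weight_cons) /=; lia.
rewrite opprB addrA subrK; move: hom => /hom_word_cat[hs /hom_word_cons[? /hom_word_cons[? ?]]].
apply: act_commutator => //.
by move: wt; rewrite !(word_weight_cat, word_weight_cons) /=; lia.
Qed.

Lemma hom_word_perm s r : perm_eq s r -> hom_word s -> hom_word r.
Proof. by move=> /perm_mem sr hs p; rewrite -sr => /hs. Qed.

Lemma word_weight_perm s r : perm_eq s r -> word_weight s = word_weight r.
Proof. exact: perm_big. Qed.

(** Letters commute modulo [S]: match the first letter of [r1] with its occurrence in [r2], move it
    there, and continue behind it. *)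
Lemma act_perm_cat s r1 r2 : perm_eq r1 r2 -> hom_word (s ++ r1) ->
  (word_weight (s ++ r1) <= t)%N ->
  S (act (s ++ r1) w - act (s ++ r2) w).
Proof.
elim: r1 s r2 => [|p r1 IH] s r2.
  by move/perm_size/esym/size0nil => ->; rewrite subrr; case: sS.
move=> pr hom wt; have : p \in r2 by rewrite -(perm_mem pr) mem_head.
move=> /path.splitPr E; case: E pr => a b pr.
have pr' : perm_eq r1 (a ++ b).
  by move: pr; rewrite perm_sym -cat1s perm_catCA perm_cons perm_sym.
apply: (@subspaceBr _ _ _ _ (act (s ++ p :: a ++ b) w - act (s ++ a ++ p :: b) w)) => //.
  rewrite opprB addrA subrK -!cat_rcons; apply: IH => //; rewrite cat_rcons //.
have pp : perm_eq (s ++ p :: r1) (s ++ p :: a ++ b).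
  by rewrite perm_cat2l perm_cons.
by apply: act_move; rewrite -?(word_weight_perm pp) //; apply: hom_word_perm pp hom.
Qed.

Lemma act_perm s r : perm_eq s r -> hom_word s -> (word_weight s <= t)%N ->
  S (act r w) -> S (act s w).
Proof.
by move=> pr hs ws Sr; apply: (subspaceBr sS _ Sr); apply: (@act_perm_cat [::]).
Qed.

(** * Trading a repeated mode, by induction on length *)

Section Length.
Variable k : nat.
Hypothesis short : forall s, hom_word s -> (word_weight s <= t)%N ->
  (size s < k)%N -> S (act s w).

(** The sum is the single letter [u_{-1} v] of weight [h1 + h2] and mode [2 * c + 1] in front of
    [r]: a word of length [k - 1], covered by [short]. *)
Lemma act_iterate (h1 h2 : nat) (u v : V) (c : int) r :
  wspace V h1 u -> wspace V h2 v -> hom_word r ->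
  (h1 + h2 + word_weight r <= t)%N -> size r = k.-2 -> (1 < k)%N ->
  S (\sum_(i \in [set: nat])
     (act [:: (h1, u, -1 - i%:Z), (h2, v, 2 * c + 1 + i%:Z) & r] w
      + act [:: (h2, v, 2 * c - i%:Z), (h1, u, i%:Z) & r] w)).
Proof.
move=> hu hv hr wt sz k1.
have -> : \sum_(i \in [set: nat])
     (act [:: (h1, u, -1 - i%:Z), (h2, v, 2 * c + 1 + i%:Z) & r] w
      + act [:: (h2, v, 2 * c - i%:Z), (h1, u, i%:Z) & r] w)
  = wm_mode W (voa_mode V u (-1) v) (2 * c + 1) (act r w).
  rewrite (iterate_formulaN1 (@wm_jacobi _ _ W)).
  by apply: eq_fsbigr => i _ /=; rewrite addrK.
have [[h hE hi]|->] := mode_wspace_nat hCFT (-1) hu hv; last first.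
  by rewrite mode0; case: sS.
apply: (@short ((h, voa_mode V u (-1) v, 2 * c + 1) :: r)) => /=.
- exact/hom_word_cons.
- by rewrite word_weight_cons /=; lia.
- by lia.
Qed.

(** In the sum of [act_iterate] every word starts with two indices adding up to [2 * c], and exactly
    one has both equal to [c]. All the others lie in [S] by assumption, hence so does this one. *)
Lemma act_repeated (h1 h2 : nat) (x y : V) (c : int) r :
  wspace V h1 x -> wspace V h2 y -> hom_word r ->
  (h1 + h2 + word_weight r <= t)%N -> size r = k.-2 -> (1 < k)%N ->
  (forall a b : int, a + b = 2 * c -> a != b ->
     S (act [:: (h1, x, a), (h2, y, b) & r] w) /\
     S (act [:: (h2, y, a), (h1, x, b) & r] w)) ->
  S (act [:: (h1, x, c), (h2, y, c) & r] w).
Proof.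
move=> hx hy hr wt sz k1 spread.
have spread_1 a b (ab : a + b = 2 * c) (nab : a != b) : S (act [:: (h1, x, a), (h2, y, b) & r] w).
  by case: (spread a b ab nab).
have spread_2 a b (ab : a + b = 2 * c) (nab : a != b) : S (act [:: (h2, y, a), (h1, x, b) & r] w).
  by case: (spread a b ab nab).
have trunc (g1 g2 : nat) (u v : V) : exists N : nat, forall i, (N <= i)%N ->
    act [:: (g1, u, -1 - i%:Z), (g2, v, 2 * c + 1 + i%:Z) & r] w
    + act [:: (g2, v, 2 * c - i%:Z), (g1, u, i%:Z) & r] w = 0.
  have [k1' H1] := @wm_truncation _ _ W u (act r w).
  have [k2' H2] := @wm_truncation _ _ W v (act r w).
  exists (`|k1'| + `|k2'| + 2 * `|c| + 1)%N => i Hi /=.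
  by rewrite H1 ?H2 ?linear0 ?addr0 //; lia.
(* For [c < 0] the word with equal indices is the first summand at [i = -1 - c]. *)
have [c0|c0] := ltP c 0.
  have [N HN] := trunc h1 h2 x y.
  have [i0 ci0] : exists i0 : nat, c = -1 - i0%:Z.
    by case: c c0 {spread spread_1 spread_2 trunc HN} => // i _; exists i; lia.
  have := subspace_fsum_isolate (i0 := i0) sS HN (act_iterate c hx hy hr wt sz k1).
  set b := act [:: (h2, y, _), _ & _] w => H.
  apply: (@subspaceBr _ _ _ _ (- b)) => //.
    have -> : act [:: (h1, x, c), (h2, y, c) & r] w
      = act [:: (h1, x, -1 - i0%:Z), (h2, y, 2 * c + 1 + i0%:Z) & r] w.
      by congr (act [:: (_, _, _), (_, _, _) & r] w); lia.
    rewrite opprK; apply: H => i ii0; apply: subspaceD => //.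
      by apply: spread_1; lia.
    by apply: spread_2; lia.
  rewrite -sub0r; apply: subspaceB => //; first by case: sS.
  by apply: spread_2; lia.
(* For [c >= 0] it is the second summand at [i = c], where the order of the letters is reversed;
   hence [x] and [y] exchange roles. *)
have [i0 ci0] : exists i0 : nat, c = i0%:Z.
  by case: c c0 {spread spread_1 spread_2 trunc} => // i _; exists i.
have [N HN] := trunc h2 h1 y x.
have wt' : (h2 + h1 + word_weight r <= t)%N by lia.
have := subspace_fsum_isolate (i0 := i0) sS HN (act_iterate c hy hx hr wt' sz k1).
set b := act [:: (h2, y, -1 - _), _ & _] w => H.
apply: (@subspaceBr _ _ _ _ (- b)) => //.
  have -> : act [:: (h1, x, c), (h2, y, c) & r] w
    = act [:: (h1, x, 2 * c - i0%:Z), (h2, y, i0%:Z) & r] w.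
    by congr (act [:: (_, _, _), (_, _, _) & r] w); lia.
  rewrite opprK addrC; apply: H => i ii0; apply: subspaceD => //.
    by apply: spread_2; lia.
  by apply: spread_1; lia.
rewrite -sub0r; apply: subspaceB => //; first by case: sS.
by apply: spread_2; lia.
Qed.

(** * Reaching distinct modes: termination of the trades *)

Section Sorting.
Variables (X : {fset V}) (L : nat).
Hypothesis kill : forall x (m : int), x \in X -> L%:Z <= m -> wm_mode W x m w = 0.
Hypothesis sorted_word : forall s, (forall p, p \in s -> p.1.2 \in X) ->
  (forall p, p \in s -> p.2 < L%:Z) -> sorted <%O [seq p.2 | p <- s] ->
  S (act s w).

(** Modulo [S] the letter [p] can be moved next to [w], which it annihilates. *)
Lemma act_large_mode s p : hom_word s -> (word_weight s <= t)%N -> p \in s ->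
  p.1.2 \in X -> L%:Z <= p.2 -> S (act s w).
Proof.
move=> hs ws ps pX pL; apply: (@act_perm _ (rem p s ++ [:: p])) => //.
  by rewrite (permPl (perm_to_rem ps)) -cat1s perm_catC.
rewrite act_cat /= kill //; by case: (act_preimage (rem p s)).
Qed.

Let defect p : int := L%:Z - p.2.

(** Twice the second elementary symmetric function of the defects: nonnegative when all indices are
    below [L], and decreased by each trade. *)
Let spread s : int := (\sum_(p <- s) defect p) ^+ 2 - \sum_(p <- s) defect p ^+ 2.

Lemma spread_ge0 s : (forall p, p \in s -> p.2 < L%:Z) -> 0 <= spread s.
Proof.
(* The sign of the sum is carried along for the cross term [2 * (d * D)]. *)
move=> sL; suff : 0 <= \sum_(p <- s) defect p /\ 0 <= spread s by case.
elim: s sL => [|p s IH] sL; first by rewrite /spread !big_nil.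
have [q qs|] := IH; first by apply: sL; rewrite inE qs orbT.
have : 0 < defect p by rewrite subr_gt0 sL ?mem_head.
rewrite /spread !big_cons; set d := defect p; set D := \sum_(q <- s) defect q.
set D2 := \sum_(q <- s) _; move=> d0 D0 h.
split; first exact: addr_ge0 (ltW d0) D0.
have -> : (d + D) ^+ 2 - (d ^+ 2 + D2) = 2 * (d * D) + (D ^+ 2 - D2) by ring.
by apply: addr_ge0 => //; rewrite mulr_ge0 // mulr_ge0 // ltW.
Qed.

(** Induction on a bound for [spread s]. Distinct modes can be sorted; a repeated one is traded, and
    each resulting word has a mode at least [L] or a smaller spread. *)
Lemma act_letter_word s : (forall p, p \in s -> p.1.2 \in X) -> hom_word s ->
  (word_weight s <= t)%N -> size s = k -> S (act s w).
Proof.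
move=> sX hs ws sk.
have [/hasP[p ps pL]|] := boolP (has (fun p : letter => L%:Z <= p.2) s).
  exact: act_large_mode (sX p ps) pL.
rewrite -all_predC => /allP sL.
have {}sL p : p \in s -> p.2 < L%:Z by move/sL; rewrite /= -ltNge.
have [n sn] : exists n : nat, spread s < n%:Z.
  by exists `|spread s|.+1%N; lia.
elim: n s sX hs ws sk sL sn => [|n IH] s sX hs ws sk sL sn.
  by have := spread_ge0 sL; lia.
have [us|] := boolP (uniq [seq p.2 | p <- s]).
  set s' := sort (relpre (fun p : letter => p.2) <=%O) s.
  have ss' : perm_eq s s' by rewrite perm_sym perm_sort.
  apply: (act_perm ss') => //; apply: sorted_word.
  - by move=> p; rewrite -(perm_mem ss'); apply: sX.
  - by move=> p; rewrite -(perm_mem ss'); apply: sL.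
  - rewrite lt_sorted_uniq_le -(perm_uniq (perm_map _ ss')) us /=.
    by rewrite -sort_map sort_le_sorted.
move=> /repeated_image[[[h1 x] c] [[[h2 y] c'] [r [sr /= cc']]]].
subst c'; apply: (act_perm sr) => //.
have := hom_word_perm sr hs => /hom_word_cons[/= hx /hom_word_cons[/= hy hr]].
have wr : (h1 + h2 + word_weight r <= t)%N.
  by move: ws; rewrite (word_weight_perm sr) !word_weight_cons /=; lia.
have kr : k = (size r).+2 by rewrite -sk (perm_size sr).
have xX : x \in X by apply: (sX (h1, x, c)); rewrite (perm_mem sr) mem_head.
have yX : y \in X.
  by apply: (sX (h2, y, c)); rewrite (perm_mem sr) !inE eqxx orbT.
have rX p : p \in r -> p.1.2 \in X.
  by move=> pr; apply: sX; rewrite (perm_mem sr) !inE pr !orbT.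
have rL p : p \in r -> p.2 < L%:Z.
  by move=> pr; apply: sL; rewrite (perm_mem sr) !inE pr !orbT.
have cL : c < L%:Z by apply: (sL (h1, x, c)); rewrite (perm_mem sr) mem_head.
have step (g1 g2 : nat) (u v : V) (a b : int) : a + b = 2 * c -> a != b ->
    u \in X -> v \in X -> wspace V g1 u -> wspace V g2 v ->
    (g1 + g2 + word_weight r <= t)%N ->
    S (act [:: (g1, u, a), (g2, v, b) & r] w).
  move=> ab nab uX vX hu hv wuv.
  set s' := [:: _, _ & r].
  have hs' : hom_word s'.
    by apply/hom_word_cons; split=> //; apply/hom_word_cons.
  have ws' : (word_weight s' <= t)%N by rewrite !word_weight_cons /=; lia.
  have [aL|aL] := leP L%:Z a.
    by apply: (act_large_mode hs' ws' (p := (g1, u, a))); rewrite ?mem_head.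
  have [bL|bL] := leP L%:Z b.
    apply: (act_large_mode hs' ws' (p := (g2, v, b))) => //.
    by rewrite !inE eqxx orbT.
  apply: IH => //.
  - by move=> p; rewrite !inE => /or3P[/eqP->|/eqP->|/rX].
  - by move=> p; rewrite !inE => /or3P[/eqP->|/eqP->|/rL].
  - move: sn; rewrite /spread !(perm_big _ sr) /= !big_cons /defect /=.
    set D := \sum_(p <- r) _; set D2 := \sum_(p <- r) _ ^+ 2.
    have -> : b = 2 * c - a by lia.
    (* Replacing [c, c] by [a, 2 * c - a] raises the sum of squared defects by
       [2 * (a - c) ^+ 2]. *)
    have : 0 < (a - c) ^+ 2.
      by rewrite exprn_even_gt0 //= subr_eq0; apply: contraNneq nab => ?; apply/eqP; lia.
    by move=> ?; nia.
have sr2 : size r = k.-2 by rewrite kr.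
have k1 : (1 < k)%N by rewrite kr.
apply: (act_repeated hx hy hr wr sr2 k1).
move=> a b ab nab; split; apply: step => //; by lia.
Qed.

Variable Xbar : {fset V}.
Hypothesis hhom : forall x : V, x \in Xbar -> homogeneous x.
Hypothesis hbasis : basis_mod (C2 V) Xbar.
Hypothesis hX : forall x, x \in Xbar -> x = vacuum V \/ x \in X.

(** The prefix [r] already has its letters in [X]. The next letter is expanded modulo [C2 V]: an
    element of [X] joins the prefix, the vacuum gives zero or a shorter word, and a product
    [a_{-2} b] lowers the weight. *)
Lemma act_hom_word_size r s : (forall p, p \in r -> p.1.2 \in X) ->
  hom_word (r ++ s) -> (word_weight (r ++ s) <= t)%N -> size (r ++ s) = k ->
  S (act (r ++ s) w).
Proof.
elim: s r => [|[[h u] m] s IH] r rX hom wt sz.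
  by rewrite cats0 in hom wt sz *; apply: act_letter_word.
move: (hom) => /hom_word_cat[hr /hom_word_cons[/= hu hs]].
rewrite act_cat /=.
have := homogeneous_mod_C2 hCFT hhom hbasis hu; move: {hom} u hu wt sz.
move=> u _ wt sz; have {}wt : (word_weight r + h + word_weight s <= t)%N.
  by move: wt; rewrite word_weight_cat word_weight_cons /=; lia.
have {}sz : (size r + size s).+1 = k by rewrite -sz size_cat /= addnS.
move: u; apply: (lspan_min (mode_preimage r m (act s w))) => /= y [[yX hy]|].
  have [->|{}yX] := hX yX; last first.
    have := IH (rcons r (h, y, m)); rewrite cat_rcons act_cat /=; apply.
    - by move=> p; rewrite mem_rcons inE => /orP[/eqP->|/rX].
    - by apply/hom_word_cat; split=> //; apply/hom_word_cons.
    - by rewrite word_weight_cat word_weight_cons /=; lia.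
    - by rewrite size_cat /= -sz addnS.
  rewrite /= wm_vacuum; case: eqP => _; last by case: (act_preimage r).
  rewrite -act_cat; apply: short.
  - exact/hom_word_cat.
  - by rewrite word_weight_cat; lia.
  - by rewrite size_cat; lia.
move=> [h1 [h2 [a [b [ha hb [hE] ->]]]]] /=.
by apply: (act_C2_letter m hr hs ha hb); lia.
Qed.

End Sorting.
End Length.
End Span.

(** * Induction on weight and length *)

Section Spanning.
Variables (S : set W) (X Xbar : {fset V}) (L : nat).
Hypothesis sS : subspace S.
Hypothesis hCFT : CFT_type V.
Hypothesis hhom : forall x : V, x \in Xbar -> homogeneous x.
Hypothesis hbasis : basis_mod (C2 V) Xbar.
Hypothesis hX : forall x, x \in Xbar -> x = vacuum V \/ x \in X.
Hypothesis kill : forall x (m : int), x \in X -> L%:Z <= m -> wm_mode W x m w = 0.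
Hypothesis sorted_word : forall s, (forall p, p \in s -> p.1.2 \in X) ->
  (forall p, p \in s -> p.2 < L%:Z) -> sorted <%O [seq p.2 | p <- s] ->
  S (act s w).

Lemma act_hom_word s : hom_word s -> S (act s w).
Proof.
(* The outer induction supplies [low] with [t = n]; the inner one, on length among words of weight
   at most [n], supplies [short]. *)
have [n] := ubnP (word_weight s); elim: n s => // n IHn s; rewrite ltnS => sn hs.
have low r : hom_word r -> (word_weight r < n)%N -> S (act r w).
  by move=> hr rn; apply: IHn.
have [k] := ubnP (size s); elim: k s sn hs => // k IHk s sn hs.
rewrite ltnS leq_eqVlt => /orP[/eqP sk|sk]; last exact: IHk.
apply: (@act_hom_word_size S n sS low hCFT k _ X L kill sorted_word Xbar hhom
  hbasis hX [::] s) => //.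
by move=> r hr rn rk; apply: IHk.
Qed.

(** By linearity each vector of [r] is split into homogeneous parts, which are appended one at a
    time to the prefix [s]. *)
Lemma act_mode_word (s : seq letter) (r : seq (V * int)) :
  hom_word s -> S (act s (mode_word (wm_mode W) r w)).
Proof.
elim: r s => [|[u m] r IH] s hs /=; first exact: act_hom_word.
have := homogeneous_span hCFT u; move: u.
apply: (lspan_min (mode_preimage sS s m _)) => u [h hu] /=.
have := IH (rcons s (h, u, m)); rewrite -cats1 act_cat; apply.
by apply/hom_word_cat; split=> //; apply/hom_word_cons.
Qed.

End Spanning.

(** * The bound [L] and admissible words *)

Lemma last_mode_vanish (x : V) (m : int) :
  (last_mode w x)%:Z < m -> wm_mode W x m w = 0.
Proof.
case: m => [m|//]; rewrite /last_mode ltz_nat.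
case: xgetP => [l _ [_ h]|none _].
  by move=> lm; rewrite -(subnKC (ltnW lm)); apply: h; rewrite subn_gt0.
(* Here [xget] took its default 0. A nonzero [x_m w] with [m >= 0] would, by truncation, give a
   largest such index, contradicting [none]. *)
apply: contrapT => xm.
have [j hj] := @wm_truncation _ _ W x w.
have ex : exists n : nat, `[< wm_mode W x n%:Z w <> 0 >] by exists m; apply/asboolP.
have ub (n : nat) : `[< wm_mode W x n%:Z w <> 0 >] -> (n <= `|j|)%N.
  by move=> /asboolP xn; rewrite leqNgt; apply/negP => jn; apply/xn/hj; lia.
have [l /asboolP xl lmax] := ex_maxnP ex ub.
apply: (none l); split=> // i i0; apply: contrapT => xi.
by have := lmax (l + i)%N (asboolT xi); lia.
Qed.

Lemma mode_bound_vanish (X : {fset V}) (x : V) (m : int) :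
  x \in X -> (mode_bound X w)%:Z <= m -> wm_mode W x m w = 0.
Proof.
move=> xX h; apply: last_mode_vanish.
have : (last_mode w x <= \max_(x <- X) last_mode w x)%N.
  exact: leq_bigmax_seq.
by move: h; rewrite /mode_bound; lia.
Qed.

(** Increasing modes have decreasing opposites [n_j]. Each value then occurs once, which [1 < Q]
    makes at most [Q - 1] times. *)
Lemma sorted_spanning_vector (X : {fset V}) (L Q : nat) s : (1 < Q)%N ->
  (forall p, p \in s -> p.1.2 \in X) -> (forall p, p \in s -> p.2 < L%:Z) ->
  sorted <%O [seq p.2 | p <- s] ->
  exists2 r : seq (V * int), admissible X L Q r & act s w = spanning_vector w r.
Proof.
move=> Q1 sX sL ss; exists [seq (p.1.2, - p.2) | p <- s]; last first.
  rewrite /spanning_vector -map_comp /mode_word /act.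
  by elim: s {sX sL ss} => //= p s ->; rewrite opprK.
pose n := [seq - m | m <- [seq p.2 | p <- s]].
rewrite /admissible; have -> : [seq a.2 | a <- [seq (p.1.2, - p.2) | p <- s]] = n.
  by rewrite /n -!map_comp.
have un : uniq n.
  rewrite map_inj_uniq; last exact: oppr_inj.
  by move: ss; rewrite lt_sorted_uniq_le => /andP[].
have dec (j j' : nat) : (j < j' < size s)%N -> n`_j' < n`_j.
  move=> /andP[jj' js]; have js0 := ltn_trans jj' js.
  have nN i : (i < size s)%N -> n`_i = - [seq p.2 | p <- s]`_i.
    by move=> si; rewrite (nth_map 0) ?size_map.
  rewrite !nN // ltrN2.
  by apply: (sorted_ltn_nth lt_trans 0 ss) => //; rewrite inE size_map.
rewrite size_map; split.
- by move=> _ /mapP[p /sX ? ->].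
- by move=> j j' /dec /ltW.
- by move=> _ /mapP[_ /mapP[p /sL ? ->] ->]; rewrite ltrN2.
- by move=> j j' /dec.
- by move=> a an _; rewrite count_uniq_mem // an; lia.
Qed.

End Words.

(** * The spanning theorem *)

Unset Implicit Arguments.

Theorem theorem1 (R : realType) (V : vertexOperatorAlgebra (complex R))
  (hCFT : CFT_type V) (hC2 : C2_cofinite V)
  (Xbar : {fset V}) (hhom : forall x : V, x \in Xbar -> homogeneous x)
  (hone : vacuum V \in Xbar) (hbasis : basis_mod (C2 V) Xbar)
  (N : nat) (hN : (0 < N)%N)
  (hNC2 : lspan (\bigcup_(i in [set i : nat | (N <= i)%N]) wspace V i%:Z)
            `<=` C2 V)
  (W : weakModule V) (w : W) (hgen : generated_by w) :
  let X : {fset V} := (Xbar `\ vacuum V)%fset in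
  let Q := repetition_bound X N in
  let L := mode_bound X w in
  lspan [set y | exists2 s : seq (V * int),
                   admissible X L Q s & y = spanning_vector w s]
  = [set: W].
Proof.
move=> X Q L; apply/seteqP; split=> // v _.
have : lspan (range (fun s => mode_word (wm_mode W) s w)) v by rewrite hgen.
set S := lspan [set y | _]; have sS : subspace S by apply: lspan_subspace.
move: v; apply: (lspan_min sS) => _ [r _ <-].
apply: (@act_mode_word _ _ W w S X Xbar L sS hCFT hhom hbasis _ _ _ [::]) => //.
- by move=> x xX; rewrite !inE xX andbT; case: eqP => [->|_]; [left|right].
- by move=> x m; apply: mode_bound_vanish.
- move=> s sX sL ss; apply: sub_lspan.
  apply: sorted_spanning_vector sX sL ss.
  (* [Q] is the successor of a maximum that is at least [N > 0], hence [1 < Q]. *)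
  by rewrite /Q /repetition_bound ltnS leq_max hN.
Qed.
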